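(* Let $G$ be an abelian group with $\operatorname{asdim}\ell\text{-}\mathcal L(G)<\infty$. Then $G$ is torsion and layerly finite.
   Context: A ballean is a triple $(X,P,B)$ where $X,P$ are sets, $P\ne\emptyset$, and $B\colon X\times P\to\mathcal P(X)$ satisfies: $x\in B(x,\alpha)$; $x\in B(y,\alpha)$ iff $y\in B(x,\alpha)$; and for all $\alpha,\beta\in P$ there is $\gamma\in P$ such that $B(B(x,\alpha),\beta)\subseteq B(x,\gamma)$ for every $x\in X$, where $B(A,\delta)=\bigcup_{y\in A}B(y,\delta)$. An extended metric (a metric allowed to take the value $\infty$) $d$ on $X$ induces the metric ballean $(X,\mathbb R_{\ge0},B_d)$, with $B_d(x,R)$ the closed ball of centre $x$ and radius $R$. A ballean $(X,P,B)$ has asymptotic dimension at most $n\in\mathbb N$ if for every $\alpha\in P$ there is a cover $\mathcal U=\mathcal U_0\cup\dots\cup\mathcal U_n$ of $X$ which is uniformly bounded (there is $\gamma\in P$ with $U\subseteq B(x,\gamma)$ for all $U\in\mathcal U$, $x\in U$) and such that for each $i$ and all distinct $U,V\in\mathcal U_i$ one has $B(U,\alpha)\cap V=\emptyset$. $\operatorname{asdim}$ is the least such $n$, and $\infty$ if there is none. For a group $G$, let $L(G)$ be the set of all subgroups of $G$. The subgroup logarithmic hyperballean $\ell\text{-}\mathcal L(G)$ is the metric ballean on $L(G)$ induced by the extended metric $d(H,K)=\log\max\{|H:H\cap K|,|K:H\cap K|\}$ if both indices are finite, and $d(H,K)=\infty$ otherwise (the base of the logarithm is any fixed real number $>1$).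 A group $G$ is layerly finite if for every positive integer $n$ the set $\{x\in G: x \text{ has order } n\}$ is finite. *)

(* Defs.v *)
From HB Require Import structures.
From mathcomp Require Import all_boot all_order all_algebra finmap.
From mathcomp Require Import all_classical all_reals.
From mathcomp Require Import interval_inference exp.

Set Implicit Arguments.
Unset Strict Implicit.
Unset Printing Implicit Defensive.

Import Order.TTheory GRing.Theory Num.Theory.

Local Open Scope classical_set_scope.
Local Open Scope ring_scope.

Record ballean : Type := Ballean {
  bsupport : Type;
  bradius : Type;
  bball : bsupport -> bradius -> set bsupport;
  radius_inhabited : inhabited bradius;
  bball_refl : forall x a, bball x a x;
  bball_sym : forall x y a, bball y a x <-> bball x a y;
  bball_comp : forall a b, exists c, forall x,
    \bigcup_(y in bball x a) bball y b `<=` bball x c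
}.

Definition set_ball (X : ballean) (A : set (bsupport X)) (a : bradius X) :
  set (bsupport X) := \bigcup_(y in A) bball y a.

Definition uniformly_bounded (X : ballean) (U : set (set (bsupport X))) : Prop :=
  exists c, forall A x, U A -> A x -> A `<=` bball x c.

Definition asdim_le (X : ballean) (n : nat) : Prop :=
  forall a : bradius X, exists U : 'I_n.+1 -> set (set (bsupport X)),
  [/\ \bigcup_i \bigcup_(A in U i) A = [set: bsupport X],
      uniformly_bounded (\bigcup_i U i) &
      forall i A B, U i A -> U i B -> A <> B -> set_ball A a `&` B = set0].

Definition asdim (X : ballean) : \bar int :=
  if pselect (exists n, `[< asdim_le X n >]) is left ex
  then ((ex_minn ex)%:Z%:E)%E else +oo%E.

Record ext_metric (R : realType) (T : Type) : Type := ExtMetric {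
  emetric :> T -> T -> \bar R;
  emetric_ge0 : forall x y, (0 <= emetric x y)%E;
  emetric_eq0 : forall x y, emetric x y = 0%E <-> x = y;
  emetric_sym : forall x y, emetric x y = emetric y x;
  emetric_triangle : forall x y z, (emetric x z <= emetric x y + emetric y z)%E
}.

Section MetricBallean.
Variables (R : realType) (T : Type) (d : ext_metric R T).

Definition closed_eball (x : T) (r : {nonneg R}) : set T :=
  [set y | (d x y <= r%:num%:E)%E].

Lemma closed_eball_refl x r : closed_eball x r x.
Proof.
by rewrite /closed_eball /= (emetric_eq0 d x x).2// lee_fin.
Qed.

Lemma closed_eball_sym x y r : closed_eball y r x <-> closed_eball x r y.
Proof. by rewrite /closed_eball /= emetric_sym. Qed.

Lemma closed_eball_comp r s : exists t, forall x,
  \bigcup_(y in closed_eball x r) closed_eball y s `<=` closed_eball x t.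
Proof.
exists (r%:num + s%:num)%R%:nng => x z [y xy yz].
by apply: (le_trans (emetric_triangle d x y z)); rewrite /= EFinD leeD.
Qed.

Definition metric_ballean : ballean :=
  @Ballean T {nonneg R} closed_eball (inhabits 0%R%:nng)
    closed_eball_refl closed_eball_sym closed_eball_comp.

End MetricBallean.

Local Open Scope group_scope.

Record subgroup (G : groupType) : Type := Subgroup {
  subgroup_set :> set G;
  subgroup_closed : group_closed [in subgroup_set]
}.

Definition left_coset (G : groupType) (x : G) (L : set G) : set G :=
  [set x * l | l in L].

Definition left_cosets (G : groupType) (H L : set G) : set (set G) :=
  [set left_coset x L | x in H].

Definition finite_index (G : groupType) (H L : set G) : Prop :=
  finite_set (left_cosets H L).

(* [fset_set] is empty on infinite sets, so this is 0 when the index is infinite. *)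
Definition subgroup_index (G : groupType) (H L : set G) : nat :=
  #|` fset_set (left_cosets H L)|.

Definition log_dist (R : realType) (b : R) (G : groupType)
    (H K : subgroup G) : \bar R :=
  if `[< finite_index H (H `&` K) /\ finite_index K (H `&` K) >]
  then (ln (maxn (subgroup_index H (H `&` K))
                 (subgroup_index K (H `&` K)))%:R / ln b)%R%:E
  else +oo%E.

Section SubgroupTheory.
Variable G : groupType.
Implicit Types (H K L : subgroup G) (x y z : G).

Lemma mem_subgroup1 H : subgroup_set H 1.
Proof. by have [+ _] := subgroup_closed H; rewrite inE. Qed.

Lemma mem_subgroupF H x y :
  subgroup_set H x -> subgroup_set H y -> subgroup_set H (x / y).
Proof.
have [_ HF] := subgroup_closed H => Hx Hy.
by have := HF x y; rewrite !inE; exact.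
Qed.

Lemma mem_subgroupV H x : subgroup_set H x -> subgroup_set H x^-1.
Proof.
by move=> Hx; rewrite -div1g; apply: mem_subgroupF => //; exact: mem_subgroup1.
Qed.

Lemma mem_subgroupM H x y :
  subgroup_set H x -> subgroup_set H y -> subgroup_set H (x * y).
Proof. by move=> Hx /mem_subgroupV Hy; rewrite -[y]invgK; exact: mem_subgroupF. Qed.

Lemma left_coset_refl H K x : left_coset x (H `&` K) x.
Proof. by exists 1; [split; exact: mem_subgroup1|rewrite mulg1]. Qed.

Lemma subgroup_index_gt0 H K : finite_index H (H `&` K) ->
  (0 < subgroup_index H (H `&` K))%N.
Proof.
move=> fin; rewrite cardfs_gt0; apply/fset0Pn.
exists (left_coset 1 (H `&` K)); rewrite in_fset_set// inE.
by exists 1 => //; exact: mem_subgroup1.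
Qed.

Lemma subgroup_index_eq1 H K : finite_index H (H `&` K) ->
  subgroup_index H (H `&` K) = 1%N -> H `<=` K.
Proof.
move=> fin /eqP /cardfs1P[C HC] x Hx.
have mem y : subgroup_set H y -> left_coset y (H `&` K) = C.
  move=> Hy; apply/eqP; rewrite -in_fset1 -HC in_fset_set// inE.
  by exists y.
have := left_coset_refl H K x; rewrite mem// -(mem 1); last exact: mem_subgroup1.
by move=> [l [_ Kl] <-]; rewrite mul1g.
Qed.

Lemma left_cosets_self H : left_cosets H (H `&` H) = [set (H : set G)].
Proof.
rewrite setIid; apply/seteqP; split=> [_ [x Hx <-]|_ ->] /=.
  apply/seteqP; split=> [_ [l Hl <-]|y Hy]; first exact: mem_subgroupM.
  by exists (x^-1 * y); rewrite ?mulVKg//; apply: mem_subgroupM => //; exact: mem_subgroupV.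
exists 1; first exact: mem_subgroup1.
by apply/seteqP; split=> [_ [l Hl <-]|y Hy]; [rewrite mul1g|exists y; rewrite ?mul1g].
Qed.

Let coset_prod H L (p : set G * set G) : set G :=
  left_coset (xget 1 p.1 * xget 1 p.2) L `&` H.

Lemma left_cosets_sub H K L : left_cosets H (H `&` L) `<=`
  coset_prod H L @` (left_cosets H (H `&` K) `*` left_cosets K (K `&` L)).
Proof.
move=> _ [x Hx <-].
set D := left_coset x (H `&` K).
have Dc : D (xget 1 D) by apply: (@xgetPex _ 1 D); exists x; exact: left_coset_refl.
set c := xget 1 D in Dc *.
have [l [Hl Kl] xlc] := Dc.
have cxE : c^-1 * x = l^-1 by rewrite -xlc invgM mulgVK.
have Kcx : subgroup_set K (c^-1 * x) by rewrite cxE; exact: mem_subgroupV.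
set E := left_coset (c^-1 * x) (K `&` L).
have Ee : E (xget 1 E).
  by apply: (@xgetPex _ 1 E); exists (c^-1 * x); exact: left_coset_refl.
set e := xget 1 E in Ee *.
have [m [Km Lm] em] := Ee.
exists (D, E); first by split; [exists x|exists (c^-1 * x)].
rewrite /coset_prod /= -/c -/e -em mulgA mulVKg.
apply/seteqP; split=> [_ [[n Ln <-] Hn]|_ [n [Hn Ln] <-]].
  rewrite -mulgA; exists (m * n) => //; split; last exact: mem_subgroupM.
  have -> : m * n = x^-1 * (x * m * n) by rewrite -(mulgA x) mulKg.
  by apply: mem_subgroupM => //; exact: mem_subgroupV.
split; last exact: mem_subgroupM.
exists (m^-1 * n); last by rewrite -mulgA mulVKg.
by apply: mem_subgroupM => //; exact: mem_subgroupV.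
Qed.

Lemma finite_index_trans H K L : finite_index H (H `&` K) ->
  finite_index K (K `&` L) -> finite_index H (H `&` L).
Proof.
move=> fHK fKL; apply: sub_finite_set (@left_cosets_sub H K L) _.
by apply: finite_image; exact: finite_setX.
Qed.

Lemma subgroup_index_trans H K L : finite_index H (H `&` K) ->
  finite_index K (K `&` L) ->
  (subgroup_index H (H `&` L) <=
   subgroup_index H (H `&` K) * subgroup_index K (K `&` L))%N.
Proof.
move=> fHK fKL; have fHL := finite_index_trans fHK fKL.
rewrite /subgroup_index -(size_allpairs (fun D E => coset_prod H L (D, E))).
apply: uniq_leq_size => [|C]; first exact: fset_uniq.
rewrite in_fset_set// inE => /(@left_cosets_sub H K L)[[D E] [/= HD KE] <-].
by apply/allpairsP; exists (D, E); rewrite !in_fset_set// !inE.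
Qed.

End SubgroupTheory.

Section LogMetric.
Variables (R : realType) (b : R) (b_gt1 : (1 < b)%R) (G : groupType).
Implicit Types H K L : subgroup G.

Let lnb_gt0 : (0 < ln b)%R. Proof. by rewrite ln_gt0. Qed.

Let max_index H K := maxn (subgroup_index H (H `&` K)) (subgroup_index K (H `&` K)).

Let commensurable H K := finite_index H (H `&` K) /\ finite_index K (H `&` K).

Let log_distE H K : commensurable H K ->
  log_dist b H K = (ln (max_index H K)%:R / ln b)%R%:E.
Proof. by move=> HK; rewrite /log_dist; case: asboolP. Qed.

Let log_distNE H K : ~ commensurable H K -> log_dist b H K = +oo%E.
Proof. by move=> HK; rewrite /log_dist; case: asboolP. Qed.

Let max_index_gt0 H K : commensurable H K -> (0 < max_index H K)%N.
Proof. by move=> [HK _]; rewrite leq_max subgroup_index_gt0. Qed.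

Lemma log_dist_ge0 H K : (0 <= log_dist b H K)%E.
Proof.
have [HK|HK] := pselect (commensurable H K); last by rewrite log_distNE.
by rewrite log_distE// lee_fin divr_ge0 ?ln_ge0 ?ler1n ?max_index_gt0 ?ltW.
Qed.

Lemma subgroup_inj H K : subgroup_set H = subgroup_set K -> H = K.
Proof.
case: H K => [H HP] [K KP] /= HK; case: _ / HK KP => KP.
by congr Subgroup; exact: Prop_irrelevance.
Qed.

Lemma log_dist_eq0 H K : log_dist b H K = 0%E <-> H = K.
Proof.
split=> [|->]; last first.
  rewrite log_distE /max_index /commensurable /finite_index /subgroup_index.
    by rewrite left_cosets_self fset_set1 cardfs1 maxnn ln1 mul0r.
  by rewrite left_cosets_self; split; exact: finite_set1.
have [HK|HK] := pselect (commensurable H K); last by rewrite log_distNE.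
rewrite log_distE// => -[] /eqP; rewrite mulf_eq0 invr_eq0 (gt_eqF lnb_gt0) orbF.
rewrite ln_eq0 ?ltr0n ?max_index_gt0// -[1%R]/(1%:R)%R eqr_nat => /eqP max1.
have [fHK fKH] := HK; rewrite setIC in fKH.
have idx1 n : (0 < n)%N -> (n <= max_index H K)%N -> n = 1%N.
  by rewrite max1; case: n => [|[]].
apply: subgroup_inj; apply/seteqP; split; apply: subgroup_index_eq1 => //.
  by apply: idx1; rewrite ?subgroup_index_gt0 ?leq_maxl.
by apply: idx1; rewrite ?subgroup_index_gt0// /max_index (setIC H K) leq_maxr.
Qed.

Lemma log_dist_sym H K : log_dist b H K = log_dist b K H.
Proof. by rewrite /log_dist setIC maxnC andC. Qed.

Lemma log_dist_triangle H K L :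
  (log_dist b H L <= log_dist b H K + log_dist b K L)%E.
Proof.
have [HK|HK] := pselect (commensurable H K); last first.
  by rewrite (log_distNE HK) addye ?leey// gt_eqF// (lt_le_trans _ (log_dist_ge0 _ _)).
have [KL|KL] := pselect (commensurable K L); last first.
  by rewrite (log_distNE KL) addey ?leey// gt_eqF// (lt_le_trans _ (log_dist_ge0 _ _)).
have [fHK fKH] := HK; have [fKL fLK] := KL.
rewrite setIC in fKH; rewrite setIC in fLK.
have HL : commensurable H L.
  by split; [exact: finite_index_trans fKL|rewrite setIC; exact: finite_index_trans fKH].
rewrite !log_distE// -EFinD lee_fin -mulrDl ler_pM2r ?invr_gt0//.
rewrite -lnM ?posrE ?ltr0n ?max_index_gt0// ler_ln ?posrE ?mulr_gt0 ?ltr0n ?max_index_gt0//.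
rewrite -natrM ler_nat geq_max; apply/andP; split.
  apply: leq_trans (subgroup_index_trans fHK fKL) _.
  by rewrite leq_mul// leq_maxl.
rewrite setIC; apply: leq_trans (subgroup_index_trans fLK fKH) _.
by rewrite mulnC leq_mul// /max_index setIC leq_maxr.
Qed.

Definition log_metric : ext_metric R (subgroup G) :=
  ExtMetric log_dist_ge0 log_dist_eq0 log_dist_sym log_dist_triangle.

Definition subgroup_log_hyperballean : ballean := metric_ballean log_metric.

End LogMetric.

Definition torsion (G : groupType) : Prop :=
  forall x : G, exists2 n, (0 < n)%N & x ^+ n = 1.

Definition has_order (G : groupType) (x : G) (n : nat) : Prop :=
  [/\ (0 < n)%N, x ^+ n = 1 & forall m, (0 < m < n)%N -> x ^+ m <> 1].

Definition layerly_finite (G : groupType) : Prop :=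
  forall n, (0 < n)%N -> finite_set [set x : G | has_order x n].

(* Main.v *)
Require Import Defs.
From mathcomp Require Import all_boot all_order all_algebra finmap.
From mathcomp Require Import all_classical all_reals.
From mathcomp Require Import interval_inference sequences exp.

Set Implicit Arguments.
Unset Strict Implicit.
Unset Printing Implicit Defensive.

Import Order.TTheory GRing.Theory Num.Theory.

(** If [G] is not torsion, or not layerly finite, then for every [n] the
    subgroups of [G] contain a coarse copy of the grid [nat ^ n.+1]: a family
    [phi] of subgroups indexed by the grid such that neighbouring subgroups are
    at bounded distance, while a subgroup close to [phi v] can only be some
    [phi w] with coordinates close to those of [v].  Such a grid forces the
    asymptotic dimension above [n].

    - If [x] has infinite order and [p_0, ..., p_n] are distinct primes, take
      [phi v] to be the cyclic group generated by the power of [x] of exponent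
      [\prod_i p_i ^ v_i].  A unit step has index [p_i]; and if [w_i] exceeds
      [u_i] by [m], then the powers [g ^ j], [j < m], of the generator [g] of
      [phi u] lie in distinct cosets of [phi w], because
      [logn p_i (j - i) < m].
    - If some layer is infinite, then so is the set of solutions of [x ^ p = 1]
      for some prime [p].  Choosing solutions greedily, each outside the finite
      group generated by the previous ones, gives a sequence [e_m] which is
      linearly independent over [F_p].  Split it into [n.+1] subsequences and
      let [phi v] be generated by the first [v_i] terms of the [i]-th one.

    That the grid has large dimension is a discrete Lebesgue covering theorem
    ([grid_not_asdim_le]).  It is derived from a discrete form of the
    Poincare-Miranda theorem: if boolean functions [f_i] on the grid are true
    where [x_i = 0] and false where [x_i = M], then some unit cube of the grid
    is one on which no [f_i] is constant ([discrete_poincare_miranda]).  Given a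
    covering by families [U_0, ..., U_n], let [f_i] hold near the members of
    [U_i] that meet the face [x_i = 0].  A base vertex of that cube lies in some
    member [A] of some [U_i], and a change of [f_i] next to it is incompatible
    with the members of [U_i] being far apart.

    Poincare-Miranda is proved by a degree argument modulo 2: the sum over the
    cubes of the box of the cup product of the coboundaries of the [f_i] is
    computed by Stokes' formula and induction on the dimension, and equals 1
    ([box_sum_cup]).  A cube with a nonzero contribution is as wanted. *)

(** * Grid points *)

Definition set_coord (I : eqType) (v : I -> nat) (a : I) (i : nat) : I -> nat :=
  fun b => if b == a then i else v b.

Definition incr_coord (I : eqType) (v : I -> nat) (a : I) : I -> nat :=
  set_coord v a (v a).+1.

Lemma set_coordC (I : eqType) (v : I -> nat) a b i j : a != b ->
  set_coord (set_coord v a i) b j = set_coord (set_coord v b j) a i.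
Proof.
move=> ab; apply/funext => c; rewrite /set_coord.
by case: (eqVneq c b) => [->|//]; rewrite eq_sym (negbTE ab).
Qed.

Lemma set_coordK (I : eqType) (v : I -> nat) a i j :
  set_coord (set_coord v a i) a j = set_coord v a j.
Proof. by apply/funext => c; rewrite /set_coord; case: eqP. Qed.

Lemma set_coord_id (I : eqType) (v : I -> nat) a i : set_coord v a i a = i.
Proof. by rewrite /set_coord eqxx. Qed.

Lemma set_coord_neq (I : eqType) (v : I -> nat) a i b : b != a ->
  set_coord v a i b = v b.
Proof. by rewrite /set_coord => /negbTE ->. Qed.

Lemma incr_coordC (I : eqType) (v : I -> nat) a b :
  incr_coord (incr_coord v a) b = incr_coord (incr_coord v b) a.
Proof.
have [->//|ab] := eqVneq a b.
by rewrite /incr_coord set_coordC// !set_coord_neq// eq_sym.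
Qed.

(** * The cup product modulo 2 on the grid *)

Section Cup.
Local Open Scope ring_scope.

Lemma addrr_F2 (x : 'F_2) : x + x = 0.
Proof. by apply: addrr_pchar2; rewrite inE. Qed.

Variable I : finType.
Implicit Types (v u : I -> nat) (f h : (I -> nat) -> 'F_2) (t : {set I}).

Lemma sum_pair_swap t (F : I -> I -> 'F_2) :
  \sum_(a in t) \sum_(b in t :\ a) F a b =
  \sum_(a in t) \sum_(b in t :\ a) F b a.
Proof.
rewrite (exchange_big_dep (mem t)) /=; last by move=> a b _ /finset.setD1P[].
apply: eq_bigr => b bt; apply: eq_bigl => a.
by rewrite !inE bt andbT andbC eq_sym.
Qed.

(** Each unordered pair is counted twice. *)
Lemma sum_pair_sym t (F : I -> I -> 'F_2) : (forall a b, F a b = F b a) ->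
  \sum_(a in t) \sum_(b in t :\ a) F a b = 0.
Proof.
move=> Fsym; pose r (a b : I) := (enum_rank a < enum_rank b)%N.
transitivity (\sum_(a in t) (\sum_(b in t :\ a) (if r a b then F a b else 0)
                  + \sum_(b in t :\ a) (if r b a then F a b else 0))).
  apply: eq_bigr => a ta; rewrite -big_split.
  apply: eq_bigr => b /finset.setD1P[ba _].
  rewrite /r; case: ltngtP; rewrite /= ?addr0 ?add0r//= => e0.
  by rewrite (enum_rank_inj (val_inj e0)) eqxx in ba.
rewrite big_split /= (sum_pair_swap t (fun a b => if r b a then F a b else 0)).
under [X in _ + X]eq_bigr => a _ do under eq_bigr => b _ do rewrite Fsym.
exact: addrr_F2.
Qed.

(** The value of the cup product of the coboundaries of the functions [fs] on
    the cube with base vertex [v] and set of directions [t]: the sum, over the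
    monotone edge paths that start at [v] and use each direction at most once,
    of the product of the variations of the [i]-th function along the [i]-th
    edge. *)
Fixpoint cup (fs : seq ((I -> nat) -> 'F_2)) (t : {set I})
    (v : I -> nat) : 'F_2 :=
  if fs is f :: fs' then
    \sum_(a in t) (f (incr_coord v a) + f v) * cup fs' (t :\ a) (incr_coord v a)
  else 1.

(** A product of coboundaries is a cocycle: on each cube it takes the same total
    value on the front faces and on the back faces. *)
Lemma cup_closed fs t v :
  \sum_(a in t) cup fs (t :\ a) (incr_coord v a) =
  \sum_(a in t) cup fs (t :\ a) v.
Proof.
elim: fs t v => [//|f fs IH] t v /=.
pose W a b := cup fs (t :\ a :\ b).
have WC a b u : W a b u = W b a u by rewrite /W !finset.setDDl finset.setUC.
(* The three terms of the expansion: at the far end of two steps the summand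
   is symmetric; after one step, and at the start, the induction hypothesis
   moves the remaining factor back by a step. *)
have E1 : \sum_(a in t) \sum_(b in t :\ a)
    f (incr_coord (incr_coord v a) b) *
    W a b (incr_coord (incr_coord v a) b) = 0.
  by apply: sum_pair_sym => a b; rewrite incr_coordC WC.
have E2 : \sum_(a in t) \sum_(b in t :\ a)
    f (incr_coord v a) * W a b (incr_coord (incr_coord v a) b) =
  \sum_(a in t) \sum_(b in t :\ a)
    f (incr_coord v b) * W a b (incr_coord v b).
  rewrite [RHS]sum_pair_swap; apply: eq_bigr => a _.
  rewrite -!mulr_sumr; congr (_ * _).
  transitivity (\sum_(b in t :\ a) W a b (incr_coord v a)); first exact: IH.
  by apply: eq_bigr => b _; exact: WC.
have E3 : \sum_(a in t) \sum_(b in t :\ a) f v * W a b (incr_coord v b) = 0.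
  under eq_bigr => a _ do rewrite -mulr_sumr IH mulr_sumr.
  by apply: sum_pair_sym => a b; congr (_ * _); exact: WC.
under eq_bigr => a _ do under eq_bigr => b _ do rewrite mulrDl.
under eq_bigr => a _ do rewrite big_split.
under [RHS]eq_bigr => a _ do under eq_bigr => b _ do rewrite mulrDl.
under [RHS]eq_bigr => a _ do rewrite big_split.
by rewrite !big_split /= E1 E2 E3 add0r addr0.
Qed.

(** The monotone paths stay in the cube, where the variations of [f] vanish.
    This kills the contribution of all but two faces of a box to Stokes'
    formula, and also that of every cube on which one of the functions is
    constant. *)
Lemma cup_const fs t v f : f \in fs ->
  (forall u, (forall b, (v b <= u b <= v b + (b \in t))%N) -> f u = f v) ->
  cup fs t v = 0.
Proof.
elim: fs t v => [//|g fs IH] t v; rewrite inE => /orP ffs fc.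
have sub a u : a \in t ->
    (forall b,
       incr_coord v a b <= u b <= incr_coord v a b + (b \in t :\ a))%N ->
    (forall b, v b <= u b <= v b + (b \in t))%N.
  move=> ta h b; have := h b; rewrite /incr_coord /set_coord !inE.
  have [->|ba] //= := eqVneq b a.
  by rewrite ta addn0 addn1 => /andP[/ltnW -> ->].
have incr a : a \in t -> f (incr_coord v a) = f v.
  move=> ta; apply/fc/(sub a) => // b; rewrite leqnn /= leq_addr //.
rewrite /=; apply: big1 => a ta.
case: ffs => [/eqP <-|ffs]; first by rewrite incr// addrr_F2 mul0r.
by rewrite (IH _ _ ffs) ?mulr0// => u hu; rewrite incr//; apply/fc/(sub a).
Qed.

Section Box.
Variable M : nat.

(** The coordinates in [s] run over [0, ..., M - 1]; the others are those of
    [v]. *)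
Fixpoint box_sum (s : seq I) h v : 'F_2 :=
  if s is a :: s' then \sum_(i < M) box_sum s' h (set_coord v a i) else h v.

Lemma eq_box_sum s h1 h2 : h1 =1 h2 -> box_sum s h1 =1 box_sum s h2.
Proof. by move=> e; elim: s => [//|a s IH] v /=; apply: eq_bigr. Qed.

Lemma box_sum_exchange s (J : finType) (P : pred J)
    (h : J -> (I -> nat) -> 'F_2) v :
  box_sum s (fun u => \sum_(j | P j) h j u) v =
  \sum_(j | P j) box_sum s (h j) v.
Proof.
elim: s v => [//|a s IH] v /=.
by rewrite exchange_big /=; apply: eq_bigr => i _.
Qed.

Lemma box_sumD s h1 h2 v :
  box_sum s (fun u => h1 u + h2 u) v = box_sum s h1 v + box_sum s h2 v.
Proof.
by elim: s v => [//|a s IH] v /=; rewrite -big_split; apply: eq_bigr => i _.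
Qed.

Lemma box_sum0 s v : box_sum s (fun=> 0) v = 0.
Proof. by elim: s v => [//|a s IH] v /=; apply: big1 => i _. Qed.

Lemma box_sum_set_coord s h v a i : a \notin s ->
  box_sum s h (set_coord v a i) = box_sum s (fun u => h (set_coord u a i)) v.
Proof.
elim: s v => [//|b s IH] v; rewrite inE negb_or => /andP[ab as_] /=.
by apply: eq_bigr => j _; rewrite set_coordC// IH.
Qed.

Lemma box_sum_telescope s a h v : uniq s -> a \in s ->
  box_sum s (fun u => h (incr_coord u a) + h u) v =
  box_sum (rem a s) (fun u => h (set_coord u a M) + h (set_coord u a 0%N)) v.
Proof.
elim: s v => [//|b s IH] v /= /andP[bs us]; rewrite inE.
have [-> _|ab /= as_] := eqVneq a b; last first.
  by apply: eq_bigr => i _; rewrite IH.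
rewrite box_sumD.
transitivity (\sum_(i < M) (box_sum s (fun u => h (set_coord u b i.+1)) v +
                            box_sum s (fun u => h (set_coord u b i)) v)).
  apply: eq_bigr => i _; rewrite box_sum_set_coord -?box_sumD//.
  apply: eq_box_sum => u.
  by rewrite /incr_coord set_coordK set_coord_id.
elim: (M) => [|n IHn]; first by rewrite big_ord0 addrr_F2.
rewrite big_ord_recr /= IHn addrC addrA; congr (_ + _).
by rewrite -addrA addrr_F2 addr0.
Qed.

End Box.

(** Stokes' formula.  By [cup_closed] the product is the coboundary of the first
    function times the product of the others, so its sum over the box reduces to
    the faces.  On the faces orthogonal to a direction [b] other than the first
    one, [f b] is constant and the product of the others vanishes; on the face
    [u a = M] the function [f a] is 0, and on the face [u a = 0] it is 1, which
    leaves the same sum in one dimension less. *)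
Lemma box_sum_cup M s (f : I -> (I -> nat) -> 'F_2) v : (0 < M)%N -> uniq s ->
  (forall a u, a \in s -> u a = 0%N -> f a u = 1) ->
  (forall a u, a \in s -> u a = M -> f a u = 0) ->
  box_sum M s (cup (map f s) [set a in s]) v = 1.
Proof.
move=> M0; elim: s v => [//|a s IH] v /= /andP[as_ us] f1 f0.
pose h b u := f a u * cup (map f s) ([set c in a :: s] :\ b) u.
transitivity (box_sum M (a :: s) (fun u => \sum_(b in [set c in a :: s])
                 (h b (incr_coord u b) + h b u)) v).
  apply: (@eq_box_sum M (a :: s)) => u.
  under eq_bigr do rewrite mulrDl.
  by rewrite !big_split /= -!mulr_sumr cup_closed.
(* The direction [a] gives the induction hypothesis, the others give 0. *)
rewrite box_sum_exchange (bigD1 a) ?inE ?eqxx// big1 ?addr0.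
  rewrite box_sum_telescope ?mem_head//= ?as_// eqxx.
  rewrite -(IH (set_coord v a 0%N))// ?box_sum_set_coord//; last 2 first.
  - by move=> b u bs; apply: f1; rewrite inE bs orbT.
  - by move=> b u bs; apply: f0; rewrite inE bs orbT.
  rewrite addr0; apply: eq_box_sum => u.
  rewrite /h f0 ?set_coord_id ?mem_head// mul0r add0r.
  rewrite f1 ?set_coord_id ?mem_head// mul1r; congr (cup _ _ _).
  by apply/setP => c; rewrite !inE; case: eqVneq => // ->; rewrite (negbTE as_).
move=> b /andP[]; rewrite inE => bas ba.
have bs : b \in s by move: bas; rewrite inE (negbTE ba).
rewrite box_sum_telescope ?inE ?bs ?orbT//= ?as_//.
rewrite -[RHS](box_sum0 M (if a == b then s else a :: rem b s) v).
apply: eq_box_sum => u.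
have face i c : (forall w, w b = i -> f b w = c) -> h b (set_coord u b i) = 0.
  move=> fc; rewrite /h (@cup_const _ _ _ (f b)) ?mulr0//; first exact: map_f.
  move=> w /(_ b); rewrite !inE eqxx /= addn0 set_coord_id -eqn_leq => /eqP wb.
  by rewrite !fc ?set_coord_id.
rewrite (face M 0) ?(face 0%N 1) ?addr0// => w wb; [exact: f1|exact: f0].
Qed.

(** If every cube had a direction whose function is constant on it, all the
    summands of [box_sum_cup] would vanish. *)
Theorem discrete_poincare_miranda M (f : I -> (I -> nat) -> bool) :
  (0 < M)%N ->
  (forall a u, u a = 0%N -> f a u) -> (forall a u, u a = M -> ~~ f a u) ->
  exists v, forall a, exists p q,
    [/\ f a p, ~~ f a q, (forall b, v b <= p b <= (v b).+1)%N
      & (forall b, v b <= q b <= (v b).+1)%N].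
Proof.
move=> M0 f1 f0.
pose F a u : 'F_2 := (f a u)%:R.
have S1 : box_sum M (enum I) (cup (map F (enum I)) [set a in enum I])
    (fun=> 0%N) = 1.
  apply: box_sum_cup => //; first exact: enum_uniq.
    by move=> a u _ /f1; rewrite /F => ->.
  by move=> a u _ /f0/negbTE; rewrite /F => ->.
have [v cv] : exists v, cup (map F (enum I)) [set a in enum I] v != 0.
  apply: contrapT => /forallNP h; move: S1.
  rewrite (_ : box_sum _ _ _ _ = box_sum M (enum I) (fun=> 0) (fun=> 0%N)).
    by rewrite box_sum0 => /esym/eqP; rewrite oner_eq0.
  by apply: eq_box_sum => u; apply/eqP/negPn/negP/h.
exists v => a.
have [u hu Fu] : exists2 u,
    (forall b, v b <= u b <= (v b).+1)%N & f a u != f a v.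
  apply: contrapT => /forall2NP h; move/eqP: cv; apply.
  apply: (@cup_const _ _ _ (F a)); first by rewrite map_f// mem_enum.
  move=> u hu; rewrite /F; congr (_%:R); congr nat_of_bool.
  have [|/negP/negPn/eqP//] := h u.
  case=> b; have := hu b; rewrite inE mem_enum addn1 //.
have hv b : (v b <= v b <= (v b).+1)%N by rewrite leqnn leqnSn.
by case fu: (f a u) Fu; case fv: (f a v) => // _; [exists u, v|exists v, u];
  split=> //; rewrite ?fu ?fv.
Qed.

End Cup.

(** * A dimension bound for balleans containing a grid *)

Local Open Scope classical_set_scope.

Lemma ball_cube (X : ballean) (I : finType) (phi : (I -> nat) -> bsupport X) c :
  (forall v a, bball (phi v) c (phi (incr_coord v a))) ->
  exists C, forall v u, (forall a, v a <= u a <= (v a).+1)%N ->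
    bball (phi v) C (phi u).
Proof.
move=> step.
suff /(_ (enum I))[C hC] : forall s : seq I, exists C, forall v u,
    (forall a, v a <= u a <= v a + (a \in s))%N -> bball (phi v) C (phi u).
  by exists C => v u vu; apply: hC => a; rewrite mem_enum addn1.
elim=> [|a s [C hC]].
  exists c => v u vu; rewrite (_ : u = v); first exact: bball_refl.
  by apply/funext => a; have := vu a; rewrite addn0 -eqn_leq => /eqP.
have [C' hC'] := bball_comp c C; exists C' => v u vu.
apply: hC'; exists (phi (set_coord v a (u a))).
  have [e|ne] := eqVneq (u a) (v a).
    rewrite (_ : set_coord _ _ _ = v); first exact: bball_refl.
    by apply/funext => b; rewrite /set_coord; case: eqVneq => // ->.
  rewrite (_ : u a = (v a).+1); first exact: step.
  have /andP[va ua] := vu a; apply/eqP; rewrite eqn_leq (_ : _ < _)%N ?andbT.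
    by rewrite (leq_trans ua)// mem_head addn1.
  by rewrite ltn_neqAle eq_sym ne.
apply: hC => b; have [->|ba] := eqVneq b a.
  by rewrite set_coord_id leqnn leq_addr.
by rewrite set_coord_neq//; have := vu b; rewrite inE (negbTE ba).
Qed.

(** A ballean containing a coarsely embedded [nat ^ n.+1] has asymptotic
    dimension greater than [n]: the discrete Lebesgue covering theorem. *)
Theorem grid_not_asdim_le (X : ballean) n
    (phi : ('I_n.+1 -> nat) -> bsupport X) c :
  (forall v a, bball (phi v) c (phi (incr_coord v a))) ->
  (forall r, exists D, forall u w a,
     bball (phi u) r (phi w) -> (w a <= u a + D)%N) ->
  ~ asdim_le X n.
Proof.
move=> /ball_cube[C hC] proper dimX.
have [alpha CC] := bball_comp C C.
have [U [Ucov [g Ubd] Usep]] := dimX alpha.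
have [gC hgC] := bball_comp g C.
have [D hD] := proper gC.
(* [f a] holds on the face [x a = 0] and within [C] of the members of [U a] that
   touch this face; those are too small to get near [x a = D.+1]. *)
pose touches a A := U a A /\ exists2 z, A (phi z) & z a = 0%N.
pose f a x := `[< x a = 0%N \/ exists A y,
  [/\ touches a A, A y & bball (phi x) C y] >].
have [//|a u ua||v vP] := @discrete_poincare_miranda _ D.+1 f.
- by apply/asboolP; left.
- move=> a u ua; apply/asboolPn; rewrite ua.
  move=> -[//|[A [y [[UA [z Az za]] Ay xy]]]].
  have: bball (phi z) gC (phi u).
    by apply: hgC; exists y; [apply: Ubd Ay => //; exists a|exact/bball_sym].
  by move=> /(hD _ _ a); rewrite ua za ltnn.
(* [A] contains the base vertex [v].  If it touches the face then [f a] holds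
   all over the cube.  If it does not, then [v] is off the face, and so is any
   other point [p] of the cube; if [f a] holds at [p], then [p] is close to
   another member of the same family, which is thus within [alpha] of [A]. *)
have [a _ [A UA Av]] : (\bigcup_a \bigcup_(A in U a) A) (phi v) by rewrite Ucov.
have [p [q [/asboolP fp /asboolPn fq vp vq]]] := vP a.
suff tA : touches a A.
  by apply: fq; right; exists A, (phi v); split=> //; apply/bball_sym/hC.
split=> //; case: fp => [p0|[B [y [[UB [z Bz za]] By py]]]].
  by exists v => //; apply/eqP; have := vp a; rewrite p0 leqn0 => /andP[].
have [<-|BA] := pselect (B = A); first by exists z.
have sep := Usep a B A UB UA BA.
exfalso; have : (set_ball B alpha `&` A) (phi v); last by rewrite sep.
split=> //; exists y => //; apply/bball_sym/CC.
by exists (phi p) => //; exact: hC.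
Qed.

Lemma asdim_lt_pinfty (X : ballean) :
  (asdim X < +oo)%E -> exists n, asdim_le X n.
Proof.
rewrite /asdim; case: pselect => [[n /asboolP h] _|]; first by exists n.
by rewrite ltxx.
Qed.

(** * Estimates for the logarithmic distance *)

Local Open Scope group_scope.

Section LogDist.
Variables (R : realType) (b : R) (b_gt1 : (1 < b)%R) (G : groupType).
Implicit Types H K L : subgroup G.

(** [H / L] is covered by the first [N] powers of [g], so that the index of [L]
    in [H] is at most [N]. *)
Definition cyclic_over H L g N : Prop :=
  [/\ subgroup_set L `<=` subgroup_set H &
      forall y, subgroup_set H y ->
        exists t l, [/\ (t < N)%N, subgroup_set L l & y = g ^+ t * l]].

(** A witness that [H] meets at least [m] cosets of [K]. *)
Definition separated H K m : Prop :=
  exists y : nat -> G, (forall j, (j < m)%N -> subgroup_set H (y j)) /\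
    (forall i j, (i < j < m)%N -> ~ subgroup_set K ((y i)^-1 * y j)).

Let lnb_gt0 : (0 < ln b)%R. Proof. by rewrite ln_gt0. Qed.

Lemma log_dist_cyclic_over H L g N : cyclic_over H L g N ->
  (log_dist b H L <= (ln N%:R / ln b)%:E)%E.
Proof.
move=> [LH cov].
have HL : subgroup_set H `&` subgroup_set L = subgroup_set L `&` subgroup_set L.
  by rewrite setIid; apply/setIidr.
set F := fun t => left_coset (g ^+ t) (subgroup_set H `&` subgroup_set L).
have sub C : left_cosets H (subgroup_set H `&` subgroup_set L) C ->
    exists2 t, (t < N)%N & F t = C.
  move=> [y Hy <-]; have [t [l [tN Ll yE]]] := cov y Hy; exists t => //.
  rewrite /F HL setIid yE; apply/seteqP; split=> _ [k Lk <-].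
    exists (l^-1 * k); last by rewrite -mulgA mulVKg.
    by apply: mem_subgroupM => //; exact: mem_subgroupV.
  by exists (l * k); [exact: mem_subgroupM|rewrite mulgA].
have fin : finite_index H (subgroup_set H `&` subgroup_set L).
  apply: (@sub_finite_set _ _ (F @` `I_N)) => [C /sub[t tN <-]|].
    by exists t.
  exact/finite_image/finite_II.
have idxN : (subgroup_index H (subgroup_set H `&` subgroup_set L) <= N)%N.
  rewrite /subgroup_index -[X in (_ <= X)%N](size_iota 0) -(size_map F).
  apply: uniq_leq_size; first exact: fset_uniq.
  move=> C; rewrite in_fset_set// inE => /sub[t tN <-].
  by apply: map_f; rewrite mem_iota.
have N0 : (0 < N)%N.
  have [t [l [tN _ _]]] := cov 1 (mem_subgroup1 _).
  exact: leq_ltn_trans tN.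
have idx1 : subgroup_index L (subgroup_set H `&` subgroup_set L) = 1%N.
  by rewrite HL /subgroup_index left_cosets_self fset_set1 cardfs1.
rewrite /log_dist; case: asboolP => [_|[]]; last first.
  by split=> //; rewrite /finite_index HL left_cosets_self; exact: finite_set1.
rewrite lee_fin ler_pM2r ?invr_gt0//.
have m0 : (0 < maxn (subgroup_index H (subgroup_set H `&` subgroup_set L)) 1)%N.
  by rewrite leq_max orbT.
by rewrite idx1 ler_ln ?posrE ?ltr0n// ler_nat geq_max idxN N0.
Qed.

Lemma log_dist_separated H K m (r : R) : separated H K m ->
  (log_dist b H K <= r%:E)%E -> (m%:R <= expR (r * ln b))%R.
Proof.
move=> [y [Hy sepy]].
rewrite /log_dist; case: asboolP => [[fH fK]|_]; last by rewrite leye_eq.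
rewrite lee_fin ler_pdivrMr//.
set M := maxn _ _ => ler.
have mM : (m <= M)%N.
  apply: leq_trans (leq_maxl _ _); rewrite /subgroup_index.
  pose F j := left_coset (y j) (subgroup_set H `&` subgroup_set K).
  rewrite -[X in (X <= _)%N](size_iota 0) -(size_map F).
  apply: uniq_leq_size => [|C /mapP[j]]; last first.
    rewrite mem_iota add0n => /= jm ->; rewrite in_fset_set// inE.
    by exists (y j) => //; exact: Hy.
  rewrite map_inj_in_uniq ?iota_uniq// => i j; rewrite !mem_iota !add0n /=.
  have sep i' j' : (j' < m)%N -> (i' < j')%N -> F i' <> F j'.
    move=> jm ij Fij; have : F j' (y j') by exact: left_coset_refl.
    rewrite -Fij => -[l [_ Kl] yE]; apply: (sepy i' j'); first by rewrite ij.
    by rewrite -yE mulKg.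
  move=> im jm Fij; case: (ltngtP i j) => // /sep.
    by move=> /(_ jm).
  by move=> /(_ im)/nesym.
have M0 : (0 < M)%N by rewrite /M leq_max subgroup_index_gt0.
rewrite (@le_trans _ _ M%:R)%R ?ler_nat//.
by rewrite -[leLHS]lnK ?posrE ?ltr0n// ler_expR.
Qed.

(** Both orientations are allowed in the hypotheses because the grids used below
    are antitone for an element of infinite order and monotone for an infinite
    layer. *)
Lemma subgroup_grid_not_asdim_le n (phi : ('I_n.+1 -> nat) -> subgroup G) N :
  (0 < N)%N ->
  (forall v a, exists g, cyclic_over (phi v) (phi (incr_coord v a)) g N \/
                         cyclic_over (phi (incr_coord v a)) (phi v) g N) ->
  (forall u w a m, (u a + m <= w a)%N ->
     separated (phi u) (phi w) m \/ separated (phi w) (phi u) m) ->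
  ~ asdim_le (subgroup_log_hyperballean b_gt1 G) n.
Proof.
move=> N0 step sep.
have c0 : (0 <= ln N%:R / ln b)%R.
  by rewrite divr_ge0 ?ln_ge0 ?ler1n// ltW.
apply: (@grid_not_asdim_le (subgroup_log_hyperballean b_gt1 G) n phi
          (NngNum c0)).
  move=> v a; rewrite /= /closed_eball /=.
  have [g [cyc|cyc]] := step v a; first exact: log_dist_cyclic_over cyc.
  by rewrite log_dist_sym; exact: log_dist_cyclic_over cyc.
move=> r; have [D hD] : exists D, (expR (r%:num * ln b) < D%:R)%R.
  by exists (Num.bound (expR (r%:num * ln b))); rewrite archi_boundP ?expR_ge0.
exists D => u w a; rewrite /= /closed_eball /= => duw.
rewrite leqNgt; apply/negP => /ltnW /sep[] s.
  by have := log_dist_separated s duw; rewrite leNgt hD.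
rewrite log_dist_sym in duw.
by have := log_dist_separated s duw; rewrite leNgt hD.
Qed.

End LogDist.

(** * Elements of infinite order *)

Section CyclicSubgroup.
Variable G : groupType.
Implicit Types (g x y : G).

Definition cycle_set g : set G := [set y | exists m n, y = g ^+ m / g ^+ n].

Lemma cycle_closed g : group_closed [in cycle_set g].
Proof.
split=> [|x y]; first by rewrite inE; exists 0%N, 0%N; rewrite mulgV.
rewrite !inE => -[m [n ->]] [m' [n' ->]]; exists (m + n')%N, (n + m')%N.
have gC i j : commute (g ^+ i) (g ^+ j) by apply/commuteX2.
rewrite invgF !expgnDr (gC n m') invgM !mulgA; congr (_ / _).
by rewrite -!mulgA; congr (_ * _); apply/commute_sym/commuteV/gC.
Qed.

Definition cyclic_subgroup g := Subgroup (cycle_closed g).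

Lemma mem_cycleX g n : cycle_set g (g ^+ n).
Proof. by exists n, 0%N; rewrite divg1. Qed.

Lemma cyclic_over_expg g p : (0 < p)%N ->
  cyclic_over (cyclic_subgroup g) (cyclic_subgroup (g ^+ p)) g p.
Proof.
move=> p0; split=> [_ [m [n ->]]|_ [m [n ->]]].
  by exists (p * m)%N, (p * n)%N; rewrite !expgnA.
(* Adding [p * n] to the exponent [m - n] makes it a natural number. *)
pose N := (m + p.-1 * n)%N.
exists (N %% p)%N, ((g ^+ p) ^+ (N %/ p) / (g ^+ p) ^+ n).
split; [by rewrite ltn_mod|by exists (N %/ p)%N, n|].
rewrite mulgA -!expgnA -expgnDr addnC mulnC -divn_eq /N.
rewrite -[X in (_ / g ^+ (X * _))](prednK p0) mulSn.
by rewrite !expgnDr invgM mulgA mulgK.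
Qed.

End CyclicSubgroup.

Lemma exists_distinct_primes k :
  exists s, [/\ uniq s, size s = k & all prime s].
Proof.
elim: k => [|k [s [us sk ps]]]; first by exists [::].
have [p mp pp] := prime_above (\max_(i <- s) i).
exists (p :: s); split; rewrite /= ?sk ?pp ?us ?andbT//.
apply/negP => pis; move: mp; rewrite ltnNge => /negP; apply.
by rewrite (big_rem p pis) leq_maxl.
Qed.

Section Torsion.
Variables (R : realType) (b : R) (b_gt1 : (1 < b)%R) (G : groupType).

(** The exponents [\prod_i p_i ^ v_i] are ordered by divisibility as the grid is
    by its product order. *)
Lemma asdim_le_torsion n :
  asdim_le (subgroup_log_hyperballean b_gt1 G) n -> torsion G.
Proof.
move=> dimG; apply: contrapT => /existsNP[x /forall2NP xn].
have xinj i j : (i <= j)%N -> x ^+ i = x ^+ j -> i = j.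
  move=> ij e; have := xn (j - i)%N; rewrite expgnFr// e mulgV => -[|//].
  move/negP; rewrite subn_gt0 -leqNgt => ji.
  by apply/eqP; rewrite eqn_leq ij ji.
have {}xinj : injective (fun i => x ^+ i).
  move=> i j e; case: (leqP i j) => [/xinj|/ltnW/xinj/(_ (esym e))//]; exact.
have [s [us sk /allP ps]] := exists_distinct_primes n.+1.
pose P (a : 'I_n.+1) := nth 0%N s a.
have Pp a : prime (P a) by apply/ps/mem_nth; rewrite sk.
pose E (v : 'I_n.+1 -> nat) := (\prod_a P a ^ v a)%N.
have E0 v : (0 < E v)%N.
  by rewrite /E prodn_gt0// => a; rewrite expn_gt0 prime_gt0.
have EP v a : logn (P a) (E v) = v a.
  have rest0 : (0 < \prod_(c | c != a) P c ^ v c)%N.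
    by apply: prodn_gt0 => c; rewrite expn_gt0 prime_gt0.
  rewrite /E (bigD1 a)//= lognM ?expn_gt0 ?(prime_gt0 (Pp _))//.
  rewrite lognX (logn_prime _ (Pp a)) eqxx muln1.
  rewrite (_ : logn _ _ = 0%N) ?addn0//.
  apply/logn_coprime; apply: (big_ind (coprime (P a))) => [|i j Pi Pj|c ca].
  - exact: coprimen1.
  - by rewrite coprimeMr Pi.
  rewrite coprimeXr// prime_coprime// dvdn_prime2// /P nth_uniq ?sk//.
  by apply: contraNN ca => /eqP/val_inj ->.
have Ebump v a : E (incr_coord v a) = (E v * P a)%N.
  rewrite /E (bigD1 a)//= [in RHS](bigD1 a)//= /incr_coord set_coord_id.
  rewrite expnSr -!mulnA.
  congr (_ * _)%N; rewrite mulnC; congr (_ * _)%N.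
  by apply: eq_bigr => c ca; rewrite set_coord_neq.
pose phi v := cyclic_subgroup (x ^+ E v).
move: dimG; apply: (@subgroup_grid_not_asdim_le _ _ _ _ _ phi (\max_a P a)).
- by apply: leq_trans (leq_bigmax ord0); rewrite prime_gt0.
- move=> v a; exists (x ^+ E v); left.
  rewrite /phi Ebump expgnA.
  have [sub cov] := cyclic_over_expg (x ^+ E v) (prime_gt0 (Pp a)).
  split=> // y /cov[t [l [tP Ll yE]]]; exists t, l; split=> //.
  by apply: leq_trans tP _; exact: leq_bigmax.
- move=> u w a m uw; left; exists (fun j => (x ^+ E u) ^+ j); split=> [j _|i j].
    exact: mem_cycleX.
  move=> /andP[ij jm] [r [t]].
  have -> : (x ^+ E u) ^- i * (x ^+ E u) ^+ j = (x ^+ E u) ^+ (j - i).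
    by rewrite -[in LHS](subnKC (ltnW ij)) expgnDr mulKg.
  move/eqP; rewrite eq_sym divg_eq -!expgnA -expgnDr => /eqP/xinj e.
  have dvd : (E w %| E u * (j - i))%N.
    have : (E w %| E u * (j - i) + E w * t)%N by rewrite -e dvdn_mulr.
    by rewrite dvdn_addl// dvdn_mulr.
  have ji0 : (0 < j - i)%N by rewrite subn_gt0.
  have := dvdn_leq_log (P a) _ dvd; rewrite muln_gt0 E0 ji0 => /(_ isT).
  rewrite lognM// !EP => wu; have := leq_trans uw wu; rewrite leq_add2l leqNgt.
  case/negP; apply: leq_trans (ltn_logl _ ji0) _.
  by apply: leq_trans (leq_subr _ _) (ltnW jm).
Qed.

End Torsion.

(** * Infinite layers *)

Section Generated.
Variable G : groupType.
Implicit Types (S T : set G) (x y e : G).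

Definition generated S : set G :=
  [set y | forall H : subgroup G, S `<=` subgroup_set H -> subgroup_set H y].

Lemma generated_closed S : group_closed [in generated S].
Proof.
split=> [|x y]; first by rewrite inE => H _; exact: mem_subgroup1.
by rewrite !inE => Sx Sy H SH; apply: mem_subgroupF; [exact: Sx|exact: Sy].
Qed.

Definition generated_subgroup S := Subgroup (generated_closed S).

Lemma sub_generated S : S `<=` generated S.
Proof. by move=> x Sx H; exact. Qed.

Lemma generated_min S (H : subgroup G) :
  S `<=` subgroup_set H -> generated S `<=` subgroup_set H.
Proof. by move=> SH x; exact. Qed.

Lemma generatedS S T : S `<=` T -> generated S `<=` generated T.
Proof. by move=> ST x Sx H TH; apply: Sx => y /ST /TH. Qed.

Lemma generated0 : generated set0 = [set 1].
Proof.
have trivial_closed : group_closed [in [set (1 : G)]].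
  by split=> [|x y]; rewrite !inE //= => -> ->; rewrite mulgV.
apply/seteqP; split=> [|_ ->].
  by apply: (@generated_min _ (Subgroup trivial_closed)).
exact: (@mem_subgroup1 _ (generated_subgroup set0)).
Qed.

Hypothesis abelG : forall x y : G, commute x y.

Lemma generated_cyclic_over S e p : (0 < p)%N -> e ^+ p = 1 ->
  cyclic_over (generated_subgroup (e |` S)) (generated_subgroup S) e p.
Proof.
move=> p0 ep; split=> [|y]; first by apply: generatedS => x; right.
pose P : set G := [set y | exists t l, generated S l /\ y = e ^+ t * l].
have P_closed : group_closed [in P].
  split=> [|x z]; rewrite !inE.
    exists 0%N, 1; split; last by rewrite mulg1.
    exact: (@mem_subgroup1 _ (generated_subgroup S)).
  move=> [t [l [Sl ->]]] [t' [l' [Sl' ->]]].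
  exists (t + p.-1 * t')%N, (l / l'); split.
    exact: (@mem_subgroupF _ (generated_subgroup S)).
  have -> : e ^+ (t + p.-1 * t') = e ^+ t / e ^+ t'.
    apply/eqP; rewrite eq_sym divg_eq -expgnDr -addnA -mulSnr prednK//.
    by rewrite expgnDr expgnA ep expg1n mulg1.
  by rewrite invgM -!mulgA; congr (_ * _); rewrite mulgA; exact: abelG.
have /(@generated_min _ (Subgroup P_closed)) PS : e |` S `<=` P.
  move=> x [->|Sx]; [exists 1%N, 1|exists 0%N, x].
    by split; [exact: (@mem_subgroup1 _ (generated_subgroup S))|rewrite mulg1].
  by split; [exact: sub_generated|rewrite mul1g].
move=> /PS [t [l [Sl ->]]]; exists (t %% p)%N, l.
split=> //; first by rewrite ltn_mod.
by rewrite {1}(divn_eq t p) mulnC expgnDr expgnA ep expg1n mul1g.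
Qed.

Lemma finite_generated (s : seq G) p : (0 < p)%N ->
  (forall x, x \in s -> x ^+ p = 1) -> finite_set (generated [set` s]).
Proof.
move=> p0; elim: s => [|e s IH] sp.
  by rewrite set_nil generated0; exact: finite_set1.
have ep : e ^+ p = 1 by apply: sp; rewrite mem_head.
have [_ cov] := generated_cyclic_over [set` s] p0 ep.
have -> : [set` e :: s] = e |` [set` s].
  by apply/seteqP; split=> x; rewrite /= inE => /predU1P.
apply: (@sub_finite_set _ _ ((fun q : nat * G => e ^+ q.1 * q.2) @`
                              (`I_p `*` generated [set` s]))).
  by move=> y /cov[t [l [tp Sl ->]]]; exists (t, l).
apply/finite_image/finite_setX; first exact: finite_II.
by apply: IH => x xs; apply: sp; rewrite inE xs orbT.
Qed.

(** Finitely many elements of exponent [p] generate a finite group, so the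
    construction never gets stuck. *)
Lemma exists_greedy_sequence p : (0 < p)%N ->
  infinite_set [set x : G | x ^+ p = 1] ->
  exists e : nat -> G, forall m, e m ^+ p = 1 /\
    ~ generated (e @` [set l | (l < m)%N]) (e m).
Proof.
move=> p0 Gp.
have next (s : seq G) : exists x, (forall y, y \in s -> y ^+ p = 1) ->
    x ^+ p = 1 /\ ~ generated [set` s] x.
  have [sp|] := pselect (forall y, y \in s -> y ^+ p = 1); last by exists 1.
  apply: contrapT => /forallNP h; apply: Gp.
  apply: (sub_finite_set _ (finite_generated p0 sp)) => x xp.
  by apply: contrapT => nx; apply: (h x).
have [f hf] := choice next.
(* The first [n] terms of the sequence, in reverse order. *)
pose pre := fix pre n := if n is n'.+1 then f (pre n') :: pre n' else [::].
have preP n y : y \in pre n -> y ^+ p = 1.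
  elim: n y => [//|n IH] y /=; rewrite inE => /predU1P[->|]; last exact: IH.
  exact: (hf (pre n) (IH)).1.
exists (fun n => f (pre n)) => m; have [fp fg] := hf (pre m) (@preP m).
split=> // g; apply: fg; apply: generatedS g => _ [l lm <-].
elim: m lm {fp} => [//|m IH]; rewrite /= ltnS leq_eqVlt inE.
by case: eqVneq => [->|_ /=]; [rewrite eqxx|move/IH => /= ->; rewrite orbT].
Qed.

(** In a dependence relation, the exponent of the term of largest index can be
    inverted modulo the prime [p], which would put this term in the group
    generated by the previous ones. *)
Lemma greedy_independent p (e : nat -> G) : prime p ->
  (forall m, e m ^+ p = 1 /\ ~ generated (e @` [set l | (l < m)%N]) (e m)) ->
  forall m, ~ generated (e @` [set~ m]) (e m).
Proof.
move=> pp he m.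
pose S n := e @` [set l | (l < n)%N /\ l <> m].
have Sm n : ~ generated (S n) (e m).
  elim: n => [|n IH].
    move=> h; apply: (he m).2; apply: generatedS h => _ [l [l0 _] <-].
    by rewrite ltn0 in l0.
  case: (ltngtP n m) => nm.
  - move=> h; apply: (he m).2; apply: generatedS h => _ [l [ln _] <-].
    by exists l => //=; exact: leq_trans nm.
  - have SSn : S n.+1 `<=` e n |` S n.
      move=> _ [l [ln lm] <-]; move: ln.
      rewrite ltnS leq_eqVlt => /predU1P[->|ln].
        by left.
      by right; exists l.
    have [_ cov] := generated_cyclic_over (S n) (prime_gt0 pp) (he n).1.
    move=> /(generatedS SSn)/cov[t [l [tp Sl eE]]].
    have [t0|t0] := posnP t; first by apply: IH; rewrite eE t0 mul1g.
    apply: (he n).2; pose K := generated_subgroup (e @` [set l | (l < n)%N]).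
    have Kl : subgroup_set K l.
      by apply: generatedS Sl => _ [i [ni _] <-]; exists i.
    have Km : subgroup_set K (e m) by apply: sub_generated; exists m.
    have Kt : subgroup_set K (e n ^+ t).
      by rewrite -(mulgK l (e n ^+ t)) -eE; exact: mem_subgroupF.
    have KX x i : subgroup_set K x -> subgroup_set K (x ^+ i).
      move=> Kx; elim: i => [|i IHi]; first exact: mem_subgroup1.
      by rewrite expgS; exact: mem_subgroupM.
    have tcop : coprime t p.
      rewrite coprime_sym prime_coprime//; apply/negP => /dvdn_leq.
      by rewrite t0 leqNgt tp => /(_ isT).
    have [u v uv _] := egcdnP p t0.
    have := KX _ u Kt; rewrite -expgnA mulnC uv (eqP tcop) addn1 expgS.
    by rewrite mulnC expgnA (he n).1 expg1n mulg1.
  - move=> h; apply: IH; apply: generatedS h => _ [l [ln lm] <-].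
    exists l => //; split=> //; move: ln.
    by rewrite ltnS leq_eqVlt => /predU1P[ln|//]; case: lm; rewrite ln nm.
(* Only finitely many generators are involved in a given element. *)
pose U : set G := \bigcup_n generated (S n).
have SS i j : (i <= j)%N -> generated (S i) `<=` generated (S j).
  move=> ij; apply: generatedS => _ [l [li lm] <-]; exists l => //.
  by split=> //; exact: leq_trans ij.
have U_closed : group_closed [in U].
  split=> [|x y]; rewrite !inE.
    by exists 0%N => //; exact: (@mem_subgroup1 _ (generated_subgroup _)).
  move=> [i _ xi] [j _ yj]; exists (maxn i j) => //.
  apply: (@mem_subgroupF _ (generated_subgroup _)).
    by apply: SS xi; rewrite leq_maxl.
  by apply: SS yj; rewrite leq_maxr.
have US : e @` [set~ m] `<=` U.
  by move=> _ [l lm <-]; exists l.+1 => //; apply: sub_generated; exists l.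
by move=> /(@generated_min _ (Subgroup U_closed) US)[n _ /Sm].
Qed.

(** Taking [p]-th powers maps the solutions of [x ^ n = 1] to those of
    [x ^ (n / p) = 1], and the nonempty fibres are cosets of the solutions of
    [x ^ p = 1]. *)
Lemma infinite_prime_layer n : (0 < n)%N ->
  infinite_set [set x : G | x ^+ n = 1] ->
  exists2 p, prime p & infinite_set [set x : G | x ^+ p = 1].
Proof.
elim/ltn_ind: n => n IH n0 infn.
have [n1|n1] := leqP n 1.
  case: infn; rewrite (_ : n = 1%N); last by apply/eqP; rewrite eqn_leq n1.
  by apply: (sub_finite_set _ (finite_set1 1)) => x /=; rewrite expg1.
have pp := pdiv_prime n1; set p := pdiv n in pp.
have nE : n = (p * (n %/ p))%N by rewrite mulnC divnK// pdiv_dvd.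
have [fp|] := pselect (finite_set [set x : G | x ^+ p = 1]); last by exists p.
have np0 : (0 < n %/ p)%N by rewrite divn_gt0 ?prime_gt0// pdiv_leq.
apply: (IH (n %/ p)%N) => //; first by rewrite ltn_Pdiv// prime_gt1.
move=> fq; apply: infn.
apply: (@sub_finite_set _ _ (\bigcup_(y in [set x : G | x ^+ (n %/ p) = 1])
                               [set x | x ^+ p = y])).
  by move=> x /= xn; exists (x ^+ p) => //=; rewrite -expgnA -nE.
apply: bigcup_finite => // y _.
have [[x0 x0y]|/forallNP no] := pselect (exists x0, x0 ^+ p = y); last first.
  by rewrite (_ : [set _ | _] = set0)//; apply/seteqP; split=> // x /no.
apply: (@sub_finite_set _ _ ((fun z => x0 * z) @` [set x | x ^+ p = 1])).
  move=> x /= xy; exists (x0^-1 * x); last by rewrite mulVKg.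
  by rewrite /= expgMn; [rewrite expVgn xy x0y mulVg|exact: abelG].
exact: finite_image.
Qed.

End Generated.

Section Layerly.
Variables (R : realType) (b : R) (b_gt1 : (1 < b)%R) (G : groupType).
Hypothesis abelG : forall x y : G, commute x y.

Lemma asdim_le_layerly_finite n :
  asdim_le (subgroup_log_hyperballean b_gt1 G) n -> layerly_finite G.
Proof.
move=> dimG N N0; apply: contrapT => infN.
have [p pp infp] : exists2 p, prime p & infinite_set [set x : G | x ^+ p = 1].
  apply: (@infinite_prime_layer _ abelG N) => // fN; apply: infN.
  by apply: (sub_finite_set _ fN) => x [].
have [e he] := exists_greedy_sequence abelG (prime_gt0 pp) infp.
have indep := greedy_independent abelG pp he.
(* The residues modulo [n.+1] split the sequence into [n.+1] subsequences. *)
pose code (a : 'I_n.+1) j := (j * n.+1 + a)%N.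
have code_inj a a' j j' : code a j = code a' j' -> a = a' /\ j = j'.
  move=> /[dup] /(congr1 (modn^~ n.+1)) + /(congr1 (divn^~ n.+1)).
  rewrite /code !modnMDl !modn_small// !divnMDl// !divn_small// !addn0.
  by move=> /val_inj.
pose A (v : 'I_n.+1 -> nat) : set nat :=
  [set m | exists a j, (j < v a)%N /\ m = code a j].
pose phi v := generated_subgroup (e @` A v).
move: dimG; apply: (@subgroup_grid_not_asdim_le _ _ _ _ _ phi p).
- exact: prime_gt0.
- move=> v a; exists (e (code a (v a))); right.
  rewrite /phi (_ : e @` A (incr_coord v a) = e (code a (v a)) |` e @` A v).
    by apply: generated_cyclic_over => //; [exact: prime_gt0|exact: (he _).1].
  rewrite -image_set1 -image_setU; congr (_ @` _).
  apply/seteqP; split=> [m [c [j [jc ->]]]|m [->|[c [j [jc ->]]]]].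
  + have [ca|ca] := eqVneq c a; last first.
      by right; exists c, j; move: jc; rewrite /incr_coord set_coord_neq.
    move: jc; rewrite {}ca /incr_coord set_coord_id ltnS leq_eqVlt.
    move=> /predU1P[->|jv].
      by left.
    by right; exists a, j.
  + by exists a, (v a); rewrite /incr_coord set_coord_id.
  + exists c, j; split=> //; apply: leq_trans jc _.
    rewrite /incr_coord /set_coord.
    by case: eqP => // ->.
- move=> u w a m uw; right; exists (fun j => e (code a (u a + j)%N)); split.
    move=> j jm; apply: sub_generated; exists (code a (u a + j)%N) => //.
    exists a, (u a + j)%N; split=> //.
    by apply: leq_trans uw; rewrite ltn_add2l.
  move=> i j /andP[ij jm] uij; apply: (indep (code a (u a + j)%N)).
  rewrite -(mulVKg (e (code a (u a + i)%N)) (e (code a (u a + j)%N))).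
  apply: (@mem_subgroupM _ (generated_subgroup _)).
    apply: sub_generated; exists (code a (u a + i)%N) => // /code_inj[_ /eqP].
    by rewrite eqn_add2l (ltn_eqF ij).
  apply: generatedS uij => _ [_ [c [l [lu ->]]] <-]; exists (code c l) => //.
  by move=> /code_inj[ca lE]; move: lu; rewrite ca lE ltnNge leq_addr.
Qed.

End Layerly.

Theorem corollary3p23 (R : realType) (b : R) (b_gt1 : (1 < b)%R)
    (G : groupType) (abelG : forall x y : G, commute x y)
    (asdim_fin : (asdim (subgroup_log_hyperballean b_gt1 G) < +oo)%E) :
  torsion G /\ layerly_finite G.
Proof.
have [n dimG] := asdim_lt_pinfty asdim_fin.
split; first exact: asdim_le_torsion dimG.
exact: asdim_le_layerly_finite abelG _ dimG.
Qed.
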